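(* Let $Q\in\mathbb{R}^{n\times n}$ be symmetric, $q\in\mathbb{R}^n$, $a_i\in\mathbb{R}^n$, $b_i\in\mathbb{R}$ ($i=1,\dots,p$), $\mathcal{F}=\{x:\langle a_i,x\rangle\le b_i,\ i=1,\dots,p\}$, and consider $$(\mathcal{P}_Q)\qquad \min_{x\in\mathcal{F}}\ \phi(x):=\tfrac12\langle Qx,x\rangle+\langle q,x\rangle .$$ Fix $\sigma>\max\{0,\lambda_{\max}(Q)\}$ and the DC decomposition $\phi=g-h$ with $g(x)=\frac\sigma2\|x\|^2+\langle q,x\rangle$, $h(x)=\frac12\langle(\sigma I-Q)x,x\rangle$ (so both are strongly convex with parameter $\rho:=\sigma-\lambda_{\max}(Q)>0$ if $\lambda_{\max}(Q)\ge0$, and $\rho:=\min\{\sigma,\sigma-\lambda_{\max}(Q)\}$ in general). Suppose $(\mathcal{P}_Q)$ has a solution, and let $\{x_k\}$ be an infinite sequence generated by Algorithm BDCA (see context) applied to this decomposition. Then $\{x_k\}$ converges geometrically to a KKT point $x^*$ of $(\mathcal{P}_Q)$: there exist $C>0$ and $\mu\in(0,1)$ such that $\|x_k-x^*\|\le C\mu^k$ for all sufficiently large $k$.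
   Context: $\lambda_{\max}(Q)$ is the largest eigenvalue of $Q$. A point $\bar x$ is a KKT point of $(\mathcal{P}_Q)$ if there exist $\mu_1,\dots,\mu_p\ge0$ with $0=Q\bar x+q+\sum_i\mu_ia_i$, $\mu_i(\langle a_i,\bar x\rangle-b_i)=0$ and $\langle a_i,\bar x\rangle\le b_i$ for all $i$. For $\bar x\in\mathcal{F}$, $I(\bar x):=\{i:\langle a_i,\bar x\rangle=b_i\}$. Algorithm BDCA for $\phi=g-h$ on $\mathcal{F}$: input $x_0\in\mathcal{F}$, $\alpha>0$, $\beta\in(0,1)$. At iteration $k$: set $u_k:=\nabla h(x_k)=(\sigma I-Q)x_k$ and let $y_k$ be the unique minimizer of $g(x)-\langle u_k,x\rangle$ over $\mathcal{F}$ (equivalently $y_k=P_{\mathcal{F}}(x_k-\frac1\sigma(Qx_k+q))$, $P_{\mathcal F}$ the Euclidean projection); set $d_k:=y_k-x_k$; if $d_k=0$ stop. If $I(y_k)\subseteq I(x_k)$: choose any $\bar\lambda_k\ge 0$, set $\lambda_k:=\bar\lambda_k$ and reduce it (to some value in $[0,\bar\lambda_k]$) so that $y_k+\lambda_kd_k\in\mathcal{F}$; then while $\phi(y_k+\lambda_kd_k)>\phi(y_k)-\alpha\lambda_k^2\|d_k\|^2$, replace $\lambda_k$ by $\beta\lambda_k$. Otherwise set $\lambda_k:=0$. Set $x_{k+1}:=y_k+\lambda_kd_k$. *)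

(* Defs.v *)
From Stdlib Require Import Reals.
From mathcomp Require Import all_boot.
Set Implicit Arguments. Unset Strict Implicit.

Local Open Scope R_scope.

Definition vec (n : nat) := 'I_n -> R.
Definition mat (n : nat) := 'I_n -> 'I_n -> R.

Definition rsum (n : nat) (f : 'I_n -> R) : R := \big[Rplus/R0]_(i < n) f i.

Definition dot n (x y : vec n) : R := rsum (fun i => x i * y i).
Definition vnorm n (x : vec n) : R := sqrt (dot x x).
Definition vadd n (x y : vec n) : vec n := fun i => x i + y i.
Definition vsub n (x y : vec n) : vec n := fun i => x i - y i.
Definition vscal n (c : R) (x : vec n) : vec n := fun i => c * x i.
Definition vzero (n : nat) : vec n := fun _ => 0.
Arguments vzero : clear implicits.
Definition mv n (Q : mat n) (x : vec n) : vec n := fun i => rsum (fun j => Q i j * x j).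

Definition mx_symmetric n (Q : mat n) : Prop := forall i j, Q i j = Q j i.

Definition is_eigenvalue n (Q : mat n) (l : R) : Prop :=
  exists v : vec n, v <> vzero n /\ mv Q v = vscal l v.

Definition sigma_admissible n (Q : mat n) (sigma : R) : Prop :=
  0 < sigma /\ forall l, is_eigenvalue Q l -> l < sigma.

Definition feasible n p (a : 'I_p -> vec n) (b : 'I_p -> R) (x : vec n) : Prop :=
  forall i, dot (a i) x <= b i.

Definition phi n (Q : mat n) (q : vec n) (x : vec n) : R :=
  / 2 * dot (mv Q x) x + dot q x.

Definition gfun n (sigma : R) (q : vec n) (x : vec n) : R :=
  sigma / 2 * dot x x + dot q x.
Definition hfun n (Q : mat n) (sigma : R) (x : vec n) : R :=
  / 2 * dot (vsub (vscal sigma x) (mv Q x)) x.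
Definition grad_h n (Q : mat n) (sigma : R) (x : vec n) : vec n :=
  vsub (vscal sigma x) (mv Q x).

Definition active n p (a : 'I_p -> vec n) (b : 'I_p -> R) (x : vec n) (i : 'I_p) : Prop :=
  dot (a i) x = b i.

Definition KKT n p (Q : mat n) (q : vec n) (a : 'I_p -> vec n) (b : 'I_p -> R)
  (x : vec n) : Prop :=
  feasible a b x /\
  exists mu : 'I_p -> R,
    (forall i, 0 <= mu i) /\
    (forall j, mv Q x j + q j + rsum (fun i => mu i * a i j) = 0) /\
    (forall i, mu i * (dot (a i) x - b i) = 0).

Definition has_solution n p (Q : mat n) (q : vec n) (a : 'I_p -> vec n) (b : 'I_p -> R) : Prop :=
  exists xs, feasible a b xs /\ forall x, feasible a b x -> phi Q q xs <= phi Q q x.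

(* y is the (unique, by strong convexity) minimizer of g(x) - <u,x> over F *)
Definition is_subproblem_min n p (sigma : R) (q : vec n) (a : 'I_p -> vec n) (b : 'I_p -> R)
  (u y : vec n) : Prop :=
  feasible a b y /\
  forall x, feasible a b x -> gfun sigma q y - dot u y <= gfun sigma q x - dot u x.

(* One (non-terminating) iteration of BDCA from x_k to x_{k+1}:
   y_k minimizes g - <grad h(x_k), .> over F, d_k = y_k - x_k <> 0;
   if I(y_k) subset I(x_k): pick lambdabar >= 0, reduce it to lam0 in [0,lambdabar]
   with y_k + lam0 d_k in F, then backtrack lam = beta^j lam0 with j the first
   index for which the Armijo-type condition holds; otherwise lam = 0;
   x_{k+1} = y_k + lam d_k. *)
Definition bdca_step n p (Q : mat n) (q : vec n) (a : 'I_p -> vec n) (b : 'I_p -> R)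
  (sigma alpha beta : R) (xk xk1 : vec n) : Prop :=
  exists yk : vec n,
    is_subproblem_min sigma q a b (grad_h Q sigma xk) yk /\
    let dk := vsub yk xk in
    dk <> vzero n /\
    exists lam : R,
      xk1 = vadd yk (vscal lam dk) /\
      (( (forall i, active a b yk i -> active a b xk i) /\
         exists lambar lam0 : R, exists j : nat,
           0 <= lambar /\ 0 <= lam0 <= lambar /\
           feasible a b (vadd yk (vscal lam0 dk)) /\
           (forall i : nat, (i < j)%nat ->
              phi Q q (vadd yk (vscal (beta ^ i * lam0) dk)) >
              phi Q q yk - alpha * (beta ^ i * lam0) ^ 2 * vnorm dk ^ 2) /\
           phi Q q (vadd yk (vscal (beta ^ j * lam0) dk)) <=
              phi Q q yk - alpha * (beta ^ j * lam0) ^ 2 * vnorm dk ^ 2 /\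
           lam = beta ^ j * lam0)
       \/
       ( ~ (forall i, active a b yk i -> active a b xk i) /\ lam = 0)).

Definition bdca_sequence n p (Q : mat n) (q : vec n) (a : 'I_p -> vec n) (b : 'I_p -> R)
  (sigma alpha beta : R) (x : nat -> vec n) : Prop :=
  feasible a b (x 0%nat) /\ 0 < alpha /\ 0 < beta < 1 /\
  forall k, bdca_step Q q a b sigma alpha beta (x k) (x (S k)).

(* Main.v *)
Require Import Defs.
From Stdlib Require Import Reals Lra FunctionalExtensionality Classical.
From mathcomp Require Import all_boot all_algebra.
From mathcomp Require Import Rstruct.
From mathcomp Require boolp.
Set Implicit Arguments. Unset Strict Implicit.
Local Open Scope R_scope.

(** The optimality condition of the subproblem gives multipliers [mu], supported
    on the active set [A] of [y_k], with [Q y_k + q + sum mu_i a_i = e_k] and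
    [|e_k| = O(|d_k|)].  For a fixed [A], the points stationary relative to the
    affine hull of the face solve a linear system (signs and inactive constraints
    are ignored), [phi] takes a single value [v_A] on them, and subtracting two
    such systems gives [phi y_k - v_A = e_k . (y_k - z) / 2] for any solution [z],
    hence [|phi y_k - v_A| = O(|d_k|^2)] by choosing [z] with a generalized inverse.
    There are finitely many [A], so eventually [v_A] is the limit [l] of
    [phi x_k], and [phi x_{k+1} - l <= D (phi x_k - phi x_{k+1})].  Thus
    [phi x_k - l] decays geometrically, and so do the steps
    [|x_{k+1} - x_k|^2 = O(phi x_k - phi x_{k+1})]. *)

(** * Finite sums of reals *)

Lemma rsumE n (f : 'I_n -> R) : rsum f = (\sum_i f i)%R.
Proof. by []. Qed.

Lemma eq_rsum n (f g : 'I_n -> R) : (forall i, f i = g i) -> rsum f = rsum g.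
Proof. by move=> fg; apply: eq_bigr => i _. Qed.

Lemma rsumD n (f g : 'I_n -> R) : rsum (fun i => f i + g i) = rsum f + rsum g.
Proof. by rewrite rsumE big_split. Qed.

Lemma rsumZ n c (f : 'I_n -> R) : rsum (fun i => c * f i) = c * rsum f.
Proof. by apply: esym; exact: (@GRing.mulr_sumr R). Qed.

Lemma rsumB n (f g : 'I_n -> R) : rsum (fun i => f i - g i) = rsum f - rsum g.
Proof.
have -> : rsum f - rsum g = rsum f + -1 * rsum g by ring.
by rewrite -rsumZ -rsumD; apply: eq_rsum => i; ring.
Qed.

Lemma rsumZr n c (f : 'I_n -> R) : rsum (fun i => f i * c) = rsum f * c.
Proof. by apply: esym; exact: (@GRing.mulr_suml R). Qed.

Lemma exchange_rsum n m (f : 'I_n -> 'I_m -> R) :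
  rsum (fun i => rsum (f i)) = rsum (fun j => rsum (fun i => f i j)).
Proof. by rewrite !rsumE exchange_big. Qed.

Lemma rsum_ge0 n (f : 'I_n -> R) : (forall i, 0 <= f i) -> 0 <= rsum f.
Proof. by move=> f0; rewrite /rsum; elim/big_ind: _ => [|u v hu hv|i _] //; lra. Qed.

Lemma rsum_le n (f g : 'I_n -> R) : (forall i, f i <= g i) -> rsum f <= rsum g.
Proof. by move=> fg; rewrite /rsum; elim/big_ind2: _ => [|u v s t hu hv|i _] //; lra. Qed.

Lemma rsum_ge_term n (f : 'I_n -> R) i : (forall j, 0 <= f j) -> f i <= rsum f.
Proof.
move=> f0; rewrite rsumE (bigD1 i) //= -[X in X <= _]Rplus_0_r.
apply: Rplus_le_compat_l; elim/big_ind: _ => [|u v hu hv|j _]; [exact: Rle_refl| |exact: f0].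
exact: Rplus_le_le_0_compat.
Qed.

Lemma rsum0 n : rsum (fun _ : 'I_n => 0) = 0.
Proof. by rewrite /rsum big1. Qed.

Lemma rsum_split n m (f : 'I_(n + m) -> R) :
  rsum f = rsum (fun i => f (lshift m i)) + rsum (fun j => f (rshift n j)).
Proof. by rewrite rsumE big_split_ord. Qed.

(** * Generalized inverse, inner product and action of a matrix *)

Lemma ginv n (M : mat n) : exists G : mat n, forall x, mv M (mv G (mv M x)) = mv M x.
Proof.
(* Matrices in MathComp act on row vectors, hence the transpose; [G] is the transpose of
   [pinvmx A]. *)
pose A : 'M[R]_n := (\matrix_(i, j) M j i)%R.
pose toV (x : vec n) : 'rV[R]_n := (\row_i x i)%R.
have mvA (B : 'M[R]_n) (x : vec n) : toV (mv (fun i j => B j i) x) = (toV x *m B)%R.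
  apply/rowP => i; rewrite !mxE /mv rsumE; apply: eq_bigr => j _.
  by rewrite mxE GRing.mulrC.
have eM : M = (fun i j => A j i) by do 2 (apply: functional_extensionality => ?); rewrite mxE.
exists (fun i j => pinvmx A j i) => x.
have /rowP H : toV (mv M (mv (fun i j => pinvmx A j i) (mv M x))) = toV (mv M x).
  by rewrite eM !mvA mulmxKpV // submxMl.
by apply: functional_extensionality => i; have := H i; rewrite !mxE.
Qed.

Lemma dotC n (x y : vec n) : dot x y = dot y x.
Proof. by apply: eq_rsum => i; ring. Qed.

Lemma dotDl n (x y z : vec n) : dot (vadd x y) z = dot x z + dot y z.
Proof. by rewrite -rsumD; apply: eq_rsum => i; rewrite /vadd; ring. Qed.

Lemma dotZl n c (x z : vec n) : dot (vscal c x) z = c * dot x z.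
Proof. by rewrite -rsumZ; apply: eq_rsum => i; rewrite /vscal; ring. Qed.

Lemma dotDr n (x y z : vec n) : dot z (vadd x y) = dot z x + dot z y.
Proof. by rewrite !(dotC z) dotDl. Qed.

Lemma dotZr n c (x z : vec n) : dot z (vscal c x) = c * dot z x.
Proof. by rewrite !(dotC z) dotZl. Qed.

Lemma vsubE n (x y : vec n) : vsub x y = vadd x (vscal (-1) y).
Proof. by apply: functional_extensionality => i; rewrite /vsub /vadd /vscal; ring. Qed.

Lemma dotBl n (x y z : vec n) : dot (vsub x y) z = dot x z - dot y z.
Proof. by rewrite vsubE dotDl dotZl; ring. Qed.

Lemma dotBr n (x y z : vec n) : dot z (vsub x y) = dot z x - dot z y.
Proof. by rewrite !(dotC z) dotBl. Qed.

Lemma mvD n (M : mat n) x y : mv M (vadd x y) = vadd (mv M x) (mv M y).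
Proof. by apply: functional_extensionality => i; apply: (dotDr x y (M i)). Qed.

Lemma mvZ n (M : mat n) c x : mv M (vscal c x) = vscal c (mv M x).
Proof. by apply: functional_extensionality => i; apply: (dotZr c x (M i)). Qed.

Lemma mvB n (M : mat n) x y : mv M (vsub x y) = vsub (mv M x) (mv M y).
Proof. by rewrite !vsubE mvD mvZ. Qed.

Definition dotE := (dotDl, dotBl, dotZl, dotDr, dotBr, dotZr).

Lemma dot_mv_sym n (M : mat n) x y : mx_symmetric M -> dot (mv M x) y = dot (mv M y) x.
Proof.
move=> sM; rewrite /dot /mv.
transitivity (rsum (fun i => rsum (fun j => M i j * x j * y i))).
  by apply: eq_rsum => i; rewrite rsumZr.
rewrite exchange_rsum; apply: eq_rsum => j; rewrite -rsumZr.
by apply: eq_rsum => i; rewrite (sM i j); ring.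
Qed.

Lemma dot_ge0 n (x : vec n) : 0 <= dot x x.
Proof. by apply: rsum_ge0 => i; exact: Rle_0_sqr. Qed.

Lemma sqr_le_dot n (x : vec n) i : x i * x i <= dot x x.
Proof. by apply: (@rsum_ge_term _ (fun i => x i * x i)) => j; exact: Rle_0_sqr. Qed.

Lemma dot_eq0 n (x : vec n) : dot x x = 0 -> x = vzero n.
Proof.
move=> x0; apply: functional_extensionality => i.
by have := sqr_le_dot x i; rewrite x0 /vzero; nra.
Qed.

Lemma dot0l n (x : vec n) : dot (vzero n) x = 0.
Proof. by rewrite -[RHS](rsum0 n); apply: eq_rsum => i; rewrite /vzero; ring. Qed.

Lemma dot_le_mean n (x y : vec n) : Rabs (dot x y) <= (dot x x + dot y y) / 2.
Proof.
have := dot_ge0 (vadd x y); have := dot_ge0 (vsub x y).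
by rewrite !dotE (dotC y x) => h1 h2; apply: Rabs_le; split; lra.
Qed.

Lemma cauchy_schwarz n (x y : vec n) : dot x y * dot x y <= dot x x * dot y y.
Proof.
(* The squared norm of [(y.y) x - (x.y) y] is [y.y] times the gap in the inequality. *)
have := dot_ge0 (vsub (vscal (dot y y) x) (vscal (dot x y) y)).
rewrite !dotE (dotC y x) => h.
case: (Req_dec (dot y y) 0) => [y0|y0].
  by rewrite y0 (dot_eq0 y0) dotC dot0l; lra.
have yp : 0 < dot y y by have := dot_ge0 y; lra.
apply: (Rmult_le_reg_l _ _ _ yp); lra.
Qed.

(** * Quadratic bounds for matrices and the spectral bound *)

Lemma mv_bound n (M : mat n) :
  exists2 K, 0 < K & forall x, dot (mv M x) (mv M x) <= K * dot x x.
Proof.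
pose s := rsum (fun i => dot (M i) (M i)).
have s0 : 0 <= s by apply: rsum_ge0 => i; exact: dot_ge0.
exists (s + 1); first lra.
move=> x; apply: (@Rle_trans _ (s * dot x x)); last by have := dot_ge0 x; nra.
by rewrite -rsumZr; apply: rsum_le => i; exact: cauchy_schwarz.
Qed.

(** Injectivity turns the generalized inverse into a left inverse, and an upper bound for the latter
    is a lower bound for [M]. *)
Lemma mv_inj_bound n (M : mat n) : (forall x, mv M x = vzero n -> x = vzero n) ->
  exists2 c, 0 < c & forall x, c * dot x x <= dot (mv M x) (mv M x).
Proof.
move=> inj; have [G MG] := ginv M; have [K K0 HK] := mv_bound G.
exists (/ K); first exact: Rinv_0_lt_compat.
move=> x; have -> : x = mv G (mv M x).
  have : vsub x (mv G (mv M x)) = vzero n.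
    apply: inj; rewrite mvB MG; apply: functional_extensionality => i.
    by rewrite /vsub /vzero; ring.
  move=> e; apply: functional_extensionality => i; have := equal_f e i.
  by rewrite /vsub /vzero; lra.
rewrite MG; apply: (Rmult_le_reg_l K) => //.
rewrite -Rmult_assoc Rinv_r; last lra.
by rewrite Rmult_1_l; exact: HK.
Qed.

(* Nonnegativity of the form of [M] at [x - t M x], for [t = 1/L] with [L] an upper
   bound of the form. *)
Lemma psd_image_bound n (M : mat n) : mx_symmetric M ->
  (forall x, 0 <= dot (mv M x) x) ->
  exists2 c, 0 < c & forall x, c * dot (mv M x) (mv M x) <= dot (mv M x) x.
Proof.
move=> sM psd; have [K K0 HK] := mv_bound M.
(* By the mean inequality, [Mw.w] is at most half of [|Mw|^2 + |w|^2], hence at most [L |w|^2]. *)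
pose L := (K + 1) / 2; have L0 : 0 < L by rewrite /L; lra.
exists (/ L); first exact: Rinv_0_lt_compat.
move=> x; set w := mv M x.
have hL : dot (mv M w) w <= L * dot w w.
  have := dot_le_mean (mv M w) w; have := HK w.
  have := Rle_abs (dot (mv M w) w); rewrite /L; lra.
have := psd (vsub x (vscal (/ L) w)).
rewrite mvB mvZ !dotE -/w (dot_mv_sym w x sM) -/w => h.
have e : / L * (/ L * (L * dot w w)) = / L * dot w w by field; lra.
have Li := Rinv_0_lt_compat _ L0.
have := Rmult_le_compat_l (/ L) _ _ (Rlt_le _ _ Li) (Rmult_le_compat_l (/ L) _ _ (Rlt_le _ _ Li) hL).
lra.
Qed.

(* The supremum [t] of the Rayleigh quotients is an eigenvalue: otherwise
   [t I - Q] is injective and positive semidefinite, hence uniformly positive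
   definite, and [t] could be lowered. *)
Lemma rayleigh_le n (Q : mat n) sigma : mx_symmetric Q ->
  sigma_admissible Q sigma -> forall v, dot (mv Q v) v <= sigma * dot v v.
Proof.
move=> sQ [_ adm] v0; apply: Rnot_lt_le => hv0.
pose E t := exists v, t * dot v v < dot (mv Q v) v.
have [K K0 HK] := mv_bound Q.
have Eub : bound E.
  exists ((K + 1) / 2) => t [v hv]; apply: Rnot_lt_le => hK.
  have := dot_le_mean (mv Q v) v; have := HK v.
  have := Rle_abs (dot (mv Q v) v); have := dot_ge0 v; nra.
have [t [ub lub]] := completeness E Eub (ex_intro _ sigma (ex_intro _ v0 hv0)).
have st : sigma <= t by apply: ub; exists v0.
have qt v : dot (mv Q v) v <= t * dot v v.
  apply: Rnot_lt_le => hv.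
  have vp : 0 < dot v v + 1 by have := dot_ge0 v; lra.
  (* The excess is divided by [|v|^2 + 1] rather than [|v|^2]: this is safe for any [v] and leaves
     the inequality at [t + e] strict. *)
  pose e := (dot (mv Q v) v - t * dot v v) / (dot v v + 1).
  have e0 : 0 < e by apply: Rdiv_lt_0_compat; lra.
  have ee : e * (dot v v + 1) = dot (mv Q v) v - t * dot v v by rewrite /e; field; lra.
  have : t + e <= t by apply: ub; exists v; nra.
  lra.
pose M : mat n := fun i j => (if i == j then t else 0) - Q i j.
have mvM v : mv M v = vsub (vscal t v) (mv Q v).
  apply: functional_extensionality => i; rewrite /mv /vsub /vscal.
  have -> : t * v i = rsum (fun j => (if i == j then t else 0) * v j).
    rewrite /rsum (bigD1 i) //= eqxx big1 => [|j /negbTE ji]; first by rewrite Rplus_0_r.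
    by rewrite eq_sym ji Rmult_0_l.
  by rewrite -rsumB; apply: eq_rsum => j; rewrite /M; ring.
have sM : mx_symmetric M by move=> i j; rewrite /M sQ eq_sym.
have [|c1 c10 H1] := @psd_image_bound n M sM.
  by move=> v; rewrite mvM !dotE; have := qt v; lra.
have [|c2 c20 H2] := @mv_inj_bound n M.
  move=> v; rewrite mvM => e; apply: NNPP => vn0.
  have : t < sigma; last lra.
  apply: adm; exists v; split=> //; apply: functional_extensionality => i.
  by have := equal_f e i; rewrite /vsub /vzero; lra.
(* The two bounds chain to [Mv.v >= c1 |Mv|^2 >= c1 c2 |v|^2], so [t - c1 * c2] still bounds all
   Rayleigh quotients. *)
have c12 : 0 < c1 * c2 by nra.
have : t <= t - c1 * c2; last lra.
apply: lub => s [v hv]; apply: Rnot_lt_le => hs.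
have h1 := H1 v; rewrite {3}mvM !dotE in h1.
have h2 := Rmult_le_compat_l c1 _ _ (Rlt_le _ _ c10) (H2 v).
have := Rmult_le_compat_r _ _ _ (dot_ge0 v) (Rlt_le _ _ hs); lra.
Qed.

(** The maximum of finitely many thresholds works. It serves to find a step length common to all
    constraints and a rank common to all active sets. *)
Lemma fin_uniform (T : finType) (P : T -> nat -> Prop) :
  (forall t m N, (m <= N)%nat -> P t m -> P t N) ->
  (forall t, exists N, P t N) -> exists N, forall t, P t N.
Proof.
move=> mono ex; have [N HN] := boolp.choice ex; exists (\max_t N t) => t.
by apply: mono (HN t); exact: leq_bigmax.
Qed.

(** * Farkas' lemma and multipliers *)

Definition lincomb n p (mu : 'I_p -> R) (a : 'I_p -> vec n) : vec n :=
  fun j => rsum (fun i => mu i * a i j).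

Lemma dot_lincomb n p (mu : 'I_p -> R) (a : 'I_p -> vec n) z :
  dot (lincomb mu a) z = rsum (fun i => mu i * dot (a i) z).
Proof.
transitivity (rsum (fun j => rsum (fun i => mu i * a i j * z j))).
  by apply: eq_rsum => j; rewrite rsumZr.
rewrite exchange_rsum; apply: eq_rsum => i; rewrite -rsumZ.
by apply: eq_rsum => j; ring.
Qed.

(* Bartl's proof: when [i0] cannot be dropped, a vector [d0] with
   [c . d0 > 0] and [a i0 . d0 = 1] lets one eliminate [a i0]. *)
Lemma farkas n p (s : seq 'I_p) : forall (a : 'I_p -> vec n) (c : vec n),
  (forall d, (forall i, i \in s -> dot (a i) d <= 0) -> dot c d <= 0) ->
  exists mu : 'I_p -> R, (forall i, 0 <= mu i) /\
    (forall i, i \notin s -> mu i = 0) /\ c = lincomb mu a.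
Proof.
elim: s => [|i0 s IH] a c Hc.
  exists (fun=> 0); split; first by move=> *; lra.
  split=> //; rewrite (@dot_eq0 _ c).
    apply: functional_extensionality => j; rewrite /lincomb -[LHS](rsum0 p).
    by apply: eq_rsum => i; ring.
  by apply: Rle_antisym; [apply: Hc | exact: dot_ge0].
case: (classic (forall d, (forall i, i \in s -> dot (a i) d <= 0) -> dot c d <= 0)).
  move=> /IH [mu [mu0 [mus e]]]; exists mu; split=> //; split=> // i.
  by rewrite inE negb_or => /andP[_ /mus].
move=> nd; have [d1 nd1] := not_all_ex_not _ _ nd.
have [Hd1 /Rnot_le_lt cd1] := imply_to_and _ _ nd1.
have ad1 : 0 < dot (a i0) d1.
  apply: Rnot_le_lt => h; suff : dot c d1 <= 0 by lra.
  by apply: Hc => i; rewrite inE => /orP[/eqP ->|/Hd1].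
pose d0 := vscal (/ dot (a i0) d1) d1.
have ad0 : dot (a i0) d0 = 1 by rewrite !dotE; field; lra.
have ip := Rinv_0_lt_compat _ ad1.
have cd0 : 0 < dot c d0 by rewrite !dotE; nra.
have Hd0 i : i \in s -> dot (a i) d0 <= 0 by move=> /Hd1 h; rewrite !dotE; nra.
clearbody d0.
(* The vector [d - (a i0 . d) d0] is orthogonal to [a i0], so [Hc] applies to it whenever [d]
   satisfies the reduced constraints; moving the correction from [d] to [a i] and [c] gives these
   reduced vectors. *)
have [|mu [mu0 [mus e]]] := IH (fun i => vsub (a i) (vscal (dot (a i) d0) (a i0)))
    (vsub c (vscal (dot c d0) (a i0))).
  move=> d Hd; have := Hc (vsub d (vscal (dot (a i0) d) d0)).
  rewrite !dotE => h.
  have -> : dot c d - dot c d0 * dot (a i0) d = dot c d - dot (a i0) d * dot c d0 by ring.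
  apply: h => i; rewrite inE => /orP[/eqP ->|/Hd]; rewrite !dotE ?ad0; first lra.
  lra.
(* This is the coefficient left on [a i0] when the reduced combination is expanded; [a i . d0 <= 0]
   on [s] makes it nonnegative. *)
pose r := dot c d0 - rsum (fun i => mu i * dot (a i) d0).
have r0 : 0 <= r.
  suff : rsum (fun i => mu i * dot (a i) d0) <= rsum (fun _ : 'I_p => 0) by rewrite rsum0 /r; lra.
  apply: rsum_le => i; case: (boolP (i \in s)) => [/Hd0|/mus ->]; last lra.
  by have := mu0 i; nra.
exists (fun i => mu i + (if i == i0 then r else 0)); split; last split.
- by move=> i; have := mu0 i; case: eqP; lra.
- move=> i; rewrite inE negb_or => /andP[/negbTE -> /mus ->]; lra.
apply: functional_extensionality => j; rewrite /lincomb.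
transitivity (rsum (fun i => mu i * a i j) + r * a i0 j); last first.
  have -> : r * a i0 j = rsum (fun i => (if i == i0 then r else 0) * a i j).
    rewrite /rsum (bigD1 i0) //= eqxx big1 => [|i /negbTE ->]; first by rewrite Rplus_0_r.
    by rewrite Rmult_0_l.
  by rewrite -rsumD; apply: eq_rsum => i; ring.
have := equal_f e j; rewrite /lincomb /vsub /vscal.
have -> : rsum (fun i => mu i * (a i j - dot (a i) d0 * a i0 j)) =
  rsum (fun i => mu i * a i j) - rsum (fun i => mu i * dot (a i) d0) * a i0 j.
  by rewrite -rsumZr -rsumB; apply: eq_rsum => i; ring.
rewrite /r; lra.
Qed.

(** A direction [d] with [a i . d <= 0] on the active constraints stays feasible for a short step,
    so the variational inequality gives [r . d >= 0]; Farkas' lemma for [-r] then yields the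
    multipliers. *)
Lemma vi_multipliers n p (a : 'I_p -> vec n) (b : 'I_p -> R) (r y : vec n) :
  feasible a b y -> (forall z, feasible a b z -> 0 <= dot r (vsub z y)) ->
  exists mu : 'I_p -> R, (forall i, 0 <= mu i) /\
    (forall i, mu i <> 0 -> dot (a i) y = b i) /\
    (forall j, r j + lincomb mu a j = 0).
Proof.
move=> fy vi; pose s := [seq i <- enum 'I_p | dot (a i) y == b i].
have mem_s i : (i \in s) = (dot (a i) y == b i) by rewrite mem_filter mem_enum andbT.
have [|mu [mu0 [mus e]]] := @farkas n p s a (vscal (-1) r).
  move=> d Hd.
  (* Steps have length [1 / (N + 1)]. The clause on all later [m] makes the predicate monotone in
     [N]. *)
  have [||N HN] := @fin_uniform 'I_p (fun i N => dot (a i) (vadd y (vscal (/ INR N.+1) d)) <= b i /\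
    forall m, (N <= m)%nat -> dot (a i) (vadd y (vscal (/ INR m.+1) d)) <= b i).
  - move=> i m N mN [h1 h2]; split; first exact: h2.
    by move=> k Nk; apply: h2; exact: leq_trans Nk.
  - move=> i; suff [N H] : exists N, forall m, (N <= m)%nat ->
        dot (a i) (vadd y (vscal (/ INR m.+1) d)) <= b i.
      by exists N; split=> //; exact: H.
    have ip m : 0 < / INR m.+1 by apply: Rinv_0_lt_compat; apply: lt_0_INR; apply/ltP.
    case: (boolP (i \in s)) => [/[dup] /Hd h|].
      rewrite mem_s => /eqP <-; exists 0%nat => m _; rewrite !dotE.
      by have := ip m; nra.
    rewrite mem_s => /eqP ne; have gap : 0 < b i - dot (a i) y by have := fy i; lra.
    have [K HK] := INR_unbounded (Rabs (dot (a i) d) / (b i - dot (a i) y)).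
    exists K => m Km; rewrite !dotE.
    have mK : INR K <= INR m.+1 by apply: le_INR; apply/leP; exact: leqW.
    have m0 : 0 < INR m.+1 by apply: lt_0_INR; apply/ltP.
    have : / INR m.+1 * dot (a i) d <= b i - dot (a i) y; last lra.
    apply: (Rmult_le_reg_l (INR m.+1)) => //.
    rewrite -Rmult_assoc Rinv_r; last lra.
    rewrite Rmult_1_l; apply: Rle_trans (Rle_abs _) _.
    have -> : Rabs (dot (a i) d) =
      (Rabs (dot (a i) d) / (b i - dot (a i) y)) * (b i - dot (a i) y) by field; lra.
    nra.
  have N0 : 0 < / INR N.+1 by apply: Rinv_0_lt_compat; apply: lt_0_INR; apply/ltP.
  have := vi (vadd y (vscal (/ INR N.+1) d)) (fun i => proj1 (HN i)).
  rewrite !dotE; nra.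
exists mu; split=> //; split.
  by move=> i ne; apply/eqP; rewrite -mem_s; apply: contraPT ne => /mus ->.
by move=> j; rewrite -e /vscal; ring.
Qed.

(** * Differences of [phi] between stationary points *)

(** The trapezoidal rule for the gradient is exact on quadratics. *)
Lemma phi_sub n (Q : mat n) (q x y : vec n) : mx_symmetric Q ->
  phi Q q y - phi Q q x =
  / 2 * dot (vadd (vadd (mv Q y) q) (vadd (mv Q x) q)) (vsub y x).
Proof. by move=> sQ; rewrite /phi !dotE (dot_mv_sym y x sQ); field. Qed.

(** Both multiplier combinations are orthogonal to [y - x], so adding them to the gradients in
    [phi_sub] replaces these by the residuals [e] and [f]. *)
Lemma phi_sub_stationary n p (Q : mat n) (q : vec n) (a : 'I_p -> vec n)
    (mu nu : 'I_p -> R) (x y e f : vec n) : mx_symmetric Q ->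
  (forall i, mu i * dot (a i) (vsub y x) = 0) ->
  (forall i, nu i * dot (a i) (vsub y x) = 0) ->
  (forall j, mv Q y j + q j + lincomb mu a j = e j) ->
  (forall j, mv Q x j + q j + lincomb nu a j = f j) ->
  phi Q q y - phi Q q x = / 2 * dot (vadd e f) (vsub y x).
Proof.
move=> sQ mu0 nu0 ey fx; rewrite phi_sub //.
have -> : vadd e f = vadd (vadd (vadd (mv Q y) q) (vadd (mv Q x) q))
    (vadd (lincomb mu a) (lincomb nu a)).
  by apply: functional_extensionality => j; rewrite /vadd -ey -fx; ring.
have l0 m : (forall i, m i * dot (a i) (vsub y x) = 0) -> dot (lincomb m a) (vsub y x) = 0.
  by move=> m0; rewrite dot_lincomb -[RHS](rsum0 p); apply: eq_rsum.
by rewrite !(dotDl _ _ (vsub y x)) !l0 //; ring.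
Qed.

(** * The linear system of stationarity on a face *)

Definition vcat n p (y : vec n) (m : vec p) : vec (n + p) :=
  fun k => match split k with inl i => y i | inr j => m j end.

Lemma vcat_lshift n p (y : vec n) (m : vec p) i : vcat y m (lshift p i) = y i.
Proof. by rewrite /vcat (unsplitK (inl _ i)). Qed.

Lemma vcat_rshift n p (y : vec n) (m : vec p) i : vcat y m (rshift n i) = m i.
Proof. by rewrite /vcat (unsplitK (inr _ i)). Qed.

Lemma eq_vec_split n p (u v : vec (n + p)) :
  (forall i, u (lshift p i) = v (lshift p i)) ->
  (forall i, u (rshift n i) = v (rshift n i)) -> u = v.
Proof.
by move=> hl hr; apply: functional_extensionality => k; case: (split_ordP k) => i ->.
Qed.

Lemma dot_split n p (u v : vec (n + p)) : dot u v =
  dot (fun i => u (lshift p i)) (fun i => v (lshift p i)) +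
  dot (fun i => u (rshift n i)) (fun i => v (rshift n i)).
Proof. exact: rsum_split. Qed.

Section Face.
Variables (n p : nat) (Q : mat n) (a : 'I_p -> vec n) (A : {set 'I_p}).

Definition restrict (m : 'I_p -> R) : 'I_p -> R := fun i => if i \in A then m i else 0.

(** The saddle-point matrix with blocks [Q], the transposed constraints, the constraints and zero.
    Constraints outside [A] are zeroed instead of removed, so that the size does not depend on
    [A]. *)
Definition kkt_mx : mat (n + p) := fun k =>
  match split k with
  | inl i => vcat (Q i) (restrict (fun l => a l i))
  | inr l => vcat (fun i => if l \in A then a l i else 0) (vzero p)
  end.

Lemma kkt_mx_lshift z j : mv kkt_mx z (lshift p j) =
  mv Q (fun i => z (lshift p i)) j + lincomb (restrict (fun i => z (rshift n i))) a j.
Proof.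
rewrite /mv rsum_split /kkt_mx (unsplitK (inl _ j)).
congr (_ + _); apply: eq_rsum => i; rewrite ?vcat_lshift ?vcat_rshift //.
by rewrite /restrict; case: ifP => _; ring.
Qed.

Lemma kkt_mx_rshift z i : mv kkt_mx z (rshift n i) =
  restrict (fun i => dot (a i) (fun j => z (lshift p j))) i.
Proof.
rewrite /mv rsum_split /kkt_mx (unsplitK (inr _ i)) /restrict.
rewrite (_ : rsum (fun j => vcat _ _ (rshift n j) * _) = 0); last first.
  by rewrite -[RHS](rsum0 p); apply: eq_rsum => j; rewrite vcat_rshift /vzero; ring.
rewrite Rplus_0_r; case: ifP => _; first by apply: eq_rsum => j; rewrite vcat_lshift.
by rewrite -[RHS](rsum0 n); apply: eq_rsum => j; rewrite vcat_lshift; ring.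
Qed.

End Face.

(* Stationarity with respect to the face [A] is a linear system
   [kkt_mx (y, mu) = c]; [phi] is constant on its solution set, and the set of
   right-hand sides for which it is solvable is closed, so that a small residual
   [e] either is impossible or puts [y] within [O(|e|)] of a solution. *)
Lemma face_value_bound n p (Q : mat n) (q : vec n) (a : 'I_p -> vec n)
    (b : 'I_p -> R) (A : {set 'I_p}) : mx_symmetric Q ->
  exists delta kappa v, 0 < delta /\ 0 < kappa /\
  forall y mu e, (forall i, i \notin A -> mu i = 0) ->
    (forall i, i \in A -> dot (a i) y = b i) ->
    (forall j, mv Q y j + q j + lincomb mu a j = e j) ->
    dot e e < delta -> Rabs (phi Q q y - v) <= kappa * dot e e.
Proof.
move=> sQ; pose L := kkt_mx Q a A.
pose c := vcat (vscal (-1) q) (restrict A b).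
have [G LG] := ginv L.
have [KL KL0 HL] := mv_bound L; have [KG KG0 HG] := mv_bound G.
have sys y mu e : (forall i, i \notin A -> mu i = 0) ->
    (forall i, i \in A -> dot (a i) y = b i) ->
    (forall j, mv Q y j + q j + lincomb mu a j = e j) ->
    mv L (vcat y mu) = vadd c (vcat e (vzero p)).
  move=> mus ya ye; apply: eq_vec_split => i.
    rewrite kkt_mx_lshift /vadd /c !vcat_lshift /vscal -ye.
    have -> : (fun i0 => vcat y mu (lshift p i0)) = y.
      by apply: functional_extensionality => k; rewrite vcat_lshift.
    have -> : restrict A (fun i0 => vcat y mu (rshift n i0)) = mu.
      apply: functional_extensionality => k; rewrite /restrict vcat_rshift.
      by case: (boolP (k \in A)) => // /mus ->.
    by ring.
  rewrite kkt_mx_rshift /vadd /c !vcat_rshift /restrict /vzero Rplus_0_r.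
  case: ifP => // /ya <-; congr dot.
  by apply: functional_extensionality => k; rewrite vcat_lshift.
have EE (e : vec n) : dot (vcat e (vzero p)) (vcat e (vzero p)) = dot e e.
  rewrite dot_split -[RHS]Rplus_0_r -(rsum0 p); congr (_ + _); apply: eq_rsum => k.
    by rewrite vcat_lshift.
  by rewrite vcat_rshift /vzero; ring.
have LGw y mu e : mv L (vcat y mu) = vadd c (vcat e (vzero p)) ->
    vadd (mv L (mv G c)) (mv L (mv G (vcat e (vzero p)))) = vadd c (vcat e (vzero p)).
  by move=> h; have := LG (vcat y mu); rewrite h !mvD.
case: (classic (mv L (mv G c) = c)) => [cR|cNR]; last first.
  (* Here [c] is outside the range of [L], whereas [c + E] is in it for any admissible [y]. Hence
     [r = E - LGE], and [|e|^2] cannot fall below a fixed multiple of [|r|^2]; the values 1 and 0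
     for [kappa] and [v] are arbitrary. *)
  pose r := vsub (mv L (mv G c)) c.
  have r0 : 0 < dot r r.
    case: (Rle_lt_or_eq_dec _ _ (dot_ge0 r)) => // /esym /dot_eq0 rz; case: cNR.
    apply: functional_extensionality => k; have := equal_f rz k.
    by rewrite /r /vsub /vzero; lra.
  have D0 : 0 < 2 + 2 * (KL * KG) by nra.
  exists (dot r r / (2 + 2 * (KL * KG))), 1, 0; split; first exact: Rdiv_lt_0_compat.
  split; first lra.
  move=> y mu e mus ya ye esmall; exfalso.
  set E := vcat e (vzero p); set F := mv L (mv G E).
  have rE : r = vsub E F.
    apply: functional_extensionality => k; have := equal_f (LGw _ _ _ (sys _ _ _ mus ya ye)) k.
    by rewrite /r /vsub /vadd -/E -/F; lra.
  have F1 : dot F F <= KL * (KG * dot E E).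
    by apply: Rle_trans (HL _) _; apply: Rmult_le_compat_l; [lra|exact: HG].
  have : dot r r <= (2 + 2 * (KL * KG)) * dot E E.
    by rewrite rE; have := dot_ge0 (vadd E F); rewrite !dotE (dotC F E); lra.
  have := Rmult_lt_compat_r _ _ _ D0 esmall.
  rewrite EE /Rdiv Rmult_assoc Rinv_l; lra.
pose left (z : vec (n + p)) : vec n := fun i => z (lshift p i).
pose mult (z : vec (n + p)) := restrict A (fun i => z (rshift n i)).
have solve z : mv L z = c ->
    (forall j, mv Q (left z) j + q j + lincomb (mult z) a j = vzero n j) /\
    (forall i, i \in A -> dot (a i) (left z) = b i).
  move=> zc; split=> [j|i iA].
    have := equal_f zc (lshift p j); rewrite kkt_mx_lshift /c vcat_lshift /vscal /vzero /left /mult.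
    by lra.
  by have := equal_f zc (rshift n i); rewrite kkt_mx_rshift /c vcat_rshift /restrict iA.
(* The value is that of the reference solution [G c]. The factor comes from [|e.(y - z)| / 2 <=
   (|e|^2 + |y - z|^2) / 4] with [|y - z|^2 <= KG |e|^2]; the threshold 1 is arbitrary. *)
exists 1, ((1 + KG) / 4), (phi Q q (left (mv G c))).
split; first lra; split; first lra.
move=> y mu e mus ya ye _.
(* Subtracting [G E] removes the residual: [z] solves the system exactly and lies within [O(|e|)] of
   [(y, mu)]. *)
set E := vcat e (vzero p); pose z := vsub (vcat y mu) (mv G E).
have zc : mv L z = c.
  have h := sys _ _ _ mus ya ye.
  rewrite /z mvB h; apply: functional_extensionality => k.
  have := equal_f (LGw _ _ _ h) k; rewrite cR /vadd /vsub -/E; lra.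
have [z1 z2] := solve _ zc; have [c1 c2] := solve _ cR.
have supp (m : 'I_p -> R) u v : (forall i, i \notin A -> m i = 0) ->
    (forall i, i \in A -> dot (a i) u = b i) -> (forall i, i \in A -> dot (a i) v = b i) ->
    forall i, m i * dot (a i) (vsub u v) = 0.
  move=> ms hu hv i; case: (boolP (i \in A)) => [iA|/ms ->]; last ring.
  by rewrite dotBr hu // hv //; ring.
have ms w : forall i, i \notin A -> mult w i = 0.
  by move=> i /negbTE iA; rewrite /mult /restrict iA.
(* [e1] compares [y] with [z]; [e2] compares two exact solutions, whose residuals vanish, so their
   values agree. *)
have e1 := phi_sub_stationary sQ (supp _ _ _ mus ya z2) (supp _ _ _ (ms z) ya z2) ye z1.
have e2 := phi_sub_stationary sQ (supp _ _ _ (ms z) z2 c2) (supp _ _ _ (ms (mv G c)) z2 c2) z1 c1.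
rewrite dotDl dot0l in e2; rewrite dotDl dot0l in e1.
have -> : phi Q q y - phi Q q (left (mv G c)) = / 2 * dot e (vsub y (left z)) by lra.
have yz : vsub y (left z) = left (mv G E).
  by apply: functional_extensionality => k; rewrite /left /z /vsub vcat_lshift; ring.
have lb : dot (left (mv G E)) (left (mv G E)) <= KG * dot e e.
  rewrite -(EE e); apply: Rle_trans (HG E); rewrite (dot_split (mv G E)).
  have := dot_ge0 (fun i => mv G E (rshift n i)); rewrite /left; lra.
rewrite yz Rabs_mult (Rabs_pos_eq (/2)); last lra.
have := dot_le_mean e (left (mv G E)); lra.
Qed.

(** * One BDCA iteration: optimality and descent *)

Lemma feasible_segment n p (a : 'I_p -> vec n) b x y t :
  feasible a b x -> feasible a b y -> 0 <= t <= 1 ->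
  feasible a b (vadd x (vscal t (vsub y x))).
Proof. by move=> fx fy t01 i; have := fx i; have := fy i; rewrite !dotE; nra. Qed.

Lemma subproblem_vi n p (Q : mat n) (q : vec n) (a : 'I_p -> vec n) b sigma x y :
  0 < sigma -> is_subproblem_min sigma q a b (grad_h Q sigma x) y ->
  forall z, feasible a b z ->
  0 <= dot (vadd (vscal sigma (vsub y x)) (vadd (mv Q x) q)) (vsub z y).
Proof.
move=> s0 [fy miny] z fz; set r := vadd _ _; set w := vsub z y.
apply: Rnot_lt_le => rw0.
have S0 : 0 <= sigma * dot w w by have := dot_ge0 w; nra.
(* With [-r.w] added to the denominator, [0 < t <= 1] holds even for [w = 0], and the first-order
   change [r.w + t sigma |w|^2 / 2] equals [(1 + t) r.w / 2 < 0], against minimality. *)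
pose t := - dot r w / (sigma * dot w w - dot r w).
have tS : t * (sigma * dot w w - dot r w) = - dot r w by rewrite /t; field; lra.
have t0 : 0 < t by apply: Rdiv_lt_0_compat; lra.
have t1 : t <= 1 by nra.
have := miny _ (feasible_segment fy fz (conj (Rlt_le _ _ t0) t1)).
rewrite -/w; clearbody w => h.
have e : gfun sigma q (vadd y (vscal t w)) =
  gfun sigma q y + t * (sigma * dot y w + dot q w) + sigma / 2 * (t * t) * dot w w.
  by rewrite /gfun !dotE (dotC w y); field.
rewrite e /grad_h dotDr dotZr in h.
have er : dot r w = sigma * dot y w + dot q w - dot (vsub (vscal sigma x) (mv Q x)) w.
  by rewrite /r !(dotDl, dotZl, dotBl); ring.
have h1 : 0 <= t * (dot r w + t * (sigma * dot w w) / 2) by rewrite er; lra.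
have : 0 <= dot r w + t * (sigma * dot w w) / 2 by apply: (Rmult_le_reg_l t); lra.
nra.
Qed.

(** The variational inequality at [z = x] bounds the linear part of the change of [phi] by
    [-sigma |d|^2]; the quadratic part is at most [sigma / 2 * |d|^2] by [rayleigh_le]. *)
Lemma subproblem_descent n p (Q : mat n) (q : vec n) (a : 'I_p -> vec n) b sigma x y :
  mx_symmetric Q -> sigma_admissible Q sigma -> feasible a b x ->
  is_subproblem_min sigma q a b (grad_h Q sigma x) y ->
  sigma / 2 * dot (vsub y x) (vsub y x) <= phi Q q x - phi Q q y.
Proof.
move=> sQ adm fx sub; have := subproblem_vi (proj1 adm) sub fx.
have := rayleigh_le sQ adm (vsub y x).
have -> : phi Q q x - phi Q q y = - (phi Q q y - phi Q q x) by ring.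
rewrite phi_sub //; set d := vsub y x.
have -> : vsub x y = vscal (-1) d.
  by apply: functional_extensionality => i; rewrite /d /vsub /vscal; ring.
have -> : mv Q y = vadd (mv Q x) (mv Q d).
  rewrite -mvD; congr mv.
  by apply: functional_extensionality => i; rewrite /d /vsub /vadd; ring.
rewrite !(dotDl, dotZl, dotZr); lra.
Qed.

(** The full step is [(1 + lam) d] and [(1 + lam)^2 <= 2 + 2 lam^2]: the descent of the subproblem
    pays for the first term, the line search for the second. *)
Lemma bdca_step_descent n p (Q : mat n) (q : vec n) (a : 'I_p -> vec n) b
    sigma alpha beta x x1 :
  mx_symmetric Q -> sigma_admissible Q sigma -> 0 < alpha -> 0 < beta < 1 ->
  feasible a b x -> bdca_step Q q a b sigma alpha beta x x1 ->
  exists y, is_subproblem_min sigma q a b (grad_h Q sigma x) y /\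
    feasible a b x1 /\ phi Q q x1 <= phi Q q y /\
    Rmin (sigma / 4) (alpha / 2) * dot (vsub x1 x) (vsub x1 x) <= phi Q q x - phi Q q x1.
Proof.
move=> sQ adm al0 be fx [y [sub [_ [lam [e1 step]]]]]; exists y; split=> //.
have des := subproblem_descent sQ adm fx sub.
set d := vsub y x in e1 step des; have d0 := dot_ge0 d.
have [lam0 [f1 arm]] : 0 <= lam /\ feasible a b x1 /\
    phi Q q x1 <= phi Q q y - alpha * (lam * lam) * dot d d.
  case: step => [[_ [lbar [l0 [j [lb0 [l0b [fl [_ [arm el]]]]]]]]]|[_ l0]].
    have bj : 0 <= beta ^ j <= 1.
      by split; [apply: pow_le; lra | rewrite -(pow1 j); apply: pow_incr; lra].
    split; first by rewrite el; nra.
    split.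
      (* As [beta ^ j] lies in [[0, 1]], backtracking stays on the segment from [y] to the feasible
         trial point. *)
      have -> : x1 = vadd y (vscal (beta ^ j) (vsub (vadd y (vscal l0 d)) y)).
        by rewrite e1 el; apply: functional_extensionality => i; rewrite /vadd /vscal /vsub; ring.
      by apply: feasible_segment => //; case: sub.
    move: arm; rewrite -el -e1 /vnorm -(Rsqr_pow2 (sqrt _)) Rsqr_sqrt // -(Rsqr_pow2 lam).
    by rewrite /Rsqr.
  have -> : x1 = y.
    by rewrite e1 l0; apply: functional_extensionality => i; rewrite /vadd /vscal; ring.
  by rewrite l0; split; [lra|split; [case: sub|lra]].
have al : 0 <= alpha * (lam * lam) * dot d d by apply: Rmult_le_pos => //; nra.
split=> //; split; first lra.
have -> : vsub x1 x = vscal (1 + lam) d.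
  by rewrite e1; apply: functional_extensionality => i; rewrite /d /vadd /vscal /vsub; ring.
rewrite !(dotZl, dotZr).
set c := Rmin _ _; have c1 : c <= sigma / 4 := Rmin_l _ _; have c2 : c <= alpha / 2 := Rmin_r _ _.
have c0 : 0 < c by apply: Rmin_pos; case: adm; lra.
have h1 : c * ((1 + lam) * (1 + lam)) <= sigma / 2 + alpha * (lam * lam).
  apply: (@Rle_trans _ (c * (2 + 2 * (lam * lam)))); first apply: Rmult_le_compat_l; first lra.
    by have := Rle_0_sqr (1 - lam); rewrite /Rsqr; lra.
  have l2 : 0 <= 2 * (lam * lam) by nra.
  by have := Rmult_le_compat_r _ _ _ l2 c2; lra.
have := Rmult_le_compat_r _ _ _ d0 h1; lra.
Qed.

(** * Limits of sequences and passage to a KKT point *)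

Lemma geometric_steps_cvg (u : nat -> R) (C mu : R) (K : nat) :
  0 <= C -> 0 < mu < 1 ->
  (forall k, (K <= k)%nat -> Rabs (u k.+1 - u k) <= C * mu ^ k) ->
  exists l, Un_cv u l /\
    forall k, (K <= k)%nat -> Rabs (u k - l) <= C / (1 - mu) * mu ^ k.
Proof.
move=> C0 mu01 step.
have tail k m : (K <= k)%nat -> Rabs (u (k + m)%nat - u k) <= C / (1 - mu) * mu ^ k.
  move=> Kk; have mk : 0 < mu ^ k by apply: pow_lt; lra.
  have mm : 0 < mu ^ m by apply: pow_lt; lra.
  (* The exact partial geometric sum, with its factor [1 - mu ^ m], makes the induction on [m]
     close. *)
  apply: (@Rle_trans _ (C / (1 - mu) * mu ^ k * (1 - mu ^ m))); last first.
    have : 0 <= C / (1 - mu) * mu ^ k.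
      by apply: Rmult_le_pos; [apply: Rle_mult_inv_pos|]; lra.
    nra.
  elim: m {mm} => [|m IH]; first by rewrite addn0 Rminus_diag Rabs_R0 /=; lra.
  have h := step (k + m)%nat (leq_trans Kk (leq_addr m k)).
  have -> : u (k + m.+1)%nat - u k =
    (u (k + m).+1 - u (k + m)%nat) + (u (k + m)%nat - u k) by rewrite addnS; ring.
  apply: Rle_trans (Rabs_triang _ _) _; apply: Rle_trans (Rplus_le_compat _ _ _ _ h IH) _.
  apply: Req_le; rewrite pow_add /=; field; lra.
have small eps : 0 < eps -> exists N, (K <= N)%nat /\ C / (1 - mu) * mu ^ N < eps.
  move=> e0; have M0 : 0 < C / (1 - mu) + 1.
    have : 0 <= C / (1 - mu) by apply: Rle_mult_inv_pos; lra.
    by lra.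
  have [|N HN] := @pow_lt_1_zero mu _ (eps / (C / (1 - mu) + 1)) (Rdiv_lt_0_compat _ _ e0 M0).
    by rewrite Rabs_pos_eq; lra.
  exists (maxn K N); split; first exact: leq_maxl.
  have mN : 0 < mu ^ maxn K N by apply: pow_lt; lra.
  have := HN (maxn K N) (leP (leq_maxr K N)); rewrite Rabs_pos_eq; last lra.
  move=> /(Rmult_lt_compat_l _ _ _ M0).
  have -> : (C / (1 - mu) + 1) * (eps / (C / (1 - mu) + 1)) = eps by field; nra.
  nra.
have [|l ul] := R_complete u.
  move=> eps e0; have [|N [KN HN]] := small (eps / 2); first lra.
  exists N => m k /leP Nm /leP Nk.
  have := tail N (m - N)%nat KN; have := tail N (k - N)%nat KN.
  rewrite !subnKC // /Rdist => h1 h2.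
  have -> : u m - u k = (u m - u N) + - (u k - u N) by ring.
  by apply: Rle_lt_trans (Rabs_triang _ _) _; rewrite Rabs_Ropp; lra.
exists l; split=> // k Kk; apply: Rnot_lt_le => h.
have [N HN] := ul _ (Rlt_Rminus _ _ h).
have := HN (k + N)%nat (leP (leq_addl k N)); have := tail k N Kk; rewrite /Rdist => h1 h2.
have := Rabs_triang (u k - u (k + N)%nat) (u (k + N)%nat - l).
rewrite (Rabs_minus_sym (u k)).
have -> : u k - u (k + N)%nat + (u (k + N)%nat - l) = u k - l by ring.
lra.
Qed.

Lemma Un_cv_const c : Un_cv (fun _ => c) c.
Proof. by move=> eps e0; exists 0%nat => k _; rewrite /Rdist Rminus_diag Rabs_R0. Qed.

Lemma Un_cv_rsum n (f : nat -> 'I_n -> R) (l : 'I_n -> R) :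
  (forall i, Un_cv (fun k => f k i) (l i)) -> Un_cv (fun k => rsum (f k)) (rsum l).
Proof.
move=> fl; rewrite /rsum; elim: (index_enum _) => [|i s IH].
  by rewrite big_nil; apply: Un_cv_ext (Un_cv_const 0) => k; rewrite big_nil.
rewrite big_cons; apply: Un_cv_ext (CV_plus _ _ _ _ (fl i) IH) => k.
by rewrite big_cons.
Qed.

Lemma Un_cv_dot n (x y : nat -> vec n) (lx ly : vec n) :
  (forall i, Un_cv (fun k => x k i) (lx i)) ->
  (forall i, Un_cv (fun k => y k i) (ly i)) ->
  Un_cv (fun k => dot (x k) (y k)) (dot lx ly).
Proof. by move=> hx hy; apply: Un_cv_rsum => i; exact: CV_mult. Qed.

Lemma vi_KKT n p (Q : mat n) (q : vec n) (a : 'I_p -> vec n) b x :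
  feasible a b x ->
  (forall z, feasible a b z -> 0 <= dot (vadd (mv Q x) q) (vsub z x)) -> KKT Q q a b x.
Proof.
move=> fx /(vi_multipliers fx) [mu [mu0 [mua e]]]; split=> //; exists mu; split=> //.
split=> // i; case: (Req_dec (mu i) 0) => [->|/mua ->]; ring.
Qed.

(** Solving the inequality for [W k.+1] gives the contraction factor [D / (1 + D)]. *)
Lemma linear_rate (W : nat -> R) D K : 0 < D -> (forall k, 0 <= W k) ->
  (forall k, (K <= k)%nat -> W k.+1 <= D * (W k - W k.+1)) ->
  exists B theta, 0 <= B /\ 0 < theta < 1 /\
    forall k, (K <= k)%nat -> W k <= B * theta ^ k.
Proof.
move=> D0 W0 HW; pose th := D / (1 + D).
have thD : th * (1 + D) = D by rewrite /th; field; lra.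
have th01 : 0 < th < 1 by split; nra.
have thK : 0 < th ^ K by apply: pow_lt; lra.
exists (W K / th ^ K), th; split; first exact: Rle_mult_inv_pos.
split=> // k /subnKC <-; elim: (k - K)%nat => [|m IH].
  by rewrite addn0; apply: Req_le; field; lra.
have h := HW _ (leq_addr m K).
have : W (K + m).+1 <= th * W (K + m)%nat.
  apply: (Rmult_le_reg_r (1 + D)); first lra.
  have -> : th * W (K + m)%nat * (1 + D) = D * W (K + m)%nat.
    by rewrite -{2}thD; ring.
  by lra.
rewrite addnS /=; nra.
Qed.

(** * Contraction of the objective gap *)

Lemma bdca_value_contraction n p (Q : mat n) (q : vec n) (a : 'I_p -> vec n) b
    sigma (x y : nat -> vec n) (l : R) :
  mx_symmetric Q -> sigma_admissible Q sigma ->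
  (forall k, feasible a b (x k)) ->
  (forall k, is_subproblem_min sigma q a b (grad_h Q sigma (x k)) (y k)) ->
  (forall k, phi Q q (x k.+1) <= phi Q q (y k)) ->
  (forall k, l <= phi Q q (x k)) -> Un_cv (fun k => phi Q q (x k)) l ->
  exists D K, 0 < D /\ forall k, (K <= k)%nat ->
    phi Q q (x k.+1) - l <= D * (phi Q q (x k) - phi Q q (x k.+1)).
Proof.
move=> sQ adm fx sub xy lx cv; have s0 : 0 < sigma by case: adm.
pose d k := vsub (y k) (x k).
(* The stationarity residual at [y k]: the subproblem uses [sigma d + Q x] where stationarity asks
   for [Q y]. *)
pose e k := vsub (mv Q (d k)) (vscal sigma (d k)).
pose V k := phi Q q (x k).
have [KQ KQ0 HQ] := mv_bound Q.
pose M := (2 * KQ + 2 * (sigma * sigma)) * (2 / sigma).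
have M0 : 0 < M by apply: Rmult_lt_0_compat; [nra|apply: Rdiv_lt_0_compat; lra].
have eM k : dot (e k) (e k) <= M * (V k - V k.+1).
  have h1 := subproblem_descent sQ adm (fx k) (sub k).
  have h2 : dot (d k) (d k) <= 2 / sigma * (V k - V k.+1).
    apply: (Rmult_le_reg_l (sigma / 2)); first lra.
    have -> : sigma / 2 * (2 / sigma * (V k - V k.+1)) = V k - V k.+1 by field; lra.
    by have := xy k; rewrite /V /d; lra.
  rewrite /M Rmult_assoc.
  apply: Rle_trans (Rmult_le_compat_l _ _ _ _ h2); last nra.
  have := HQ (d k); have := dot_ge0 (vadd (mv Q (d k)) (vscal sigma (d k))).
  rewrite /e; move: (d k) => dk; rewrite !dotE (dotC dk (mv Q dk)); lra.
have small eps : 0 < eps -> exists N, forall k, (N <= k)%nat -> V k - l < eps.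
  move=> e0; have [N HN] := cv _ e0; exists N => k /leP Nk.
  have := HN k Nk; have := Rle_abs (V k - l); rewrite /Rdist -/(V k); lra.
pose act k := [set i | dot (a i) (y k) == b i].
have face A delta kappa v k : act k = A ->
    (forall y mu e, (forall i, i \notin A -> mu i = 0) ->
      (forall i, i \in A -> dot (a i) y = b i) ->
      (forall j, mv Q y j + q j + lincomb mu a j = e j) ->
      dot e e < delta -> Rabs (phi Q q y - v) <= kappa * dot e e) ->
    dot (e k) (e k) < delta -> Rabs (phi Q q (y k) - v) <= kappa * dot (e k) (e k).
  move=> <- H; have [mu [_ [mua emu]]] := vi_multipliers (proj1 (sub k)) (subproblem_vi s0 (sub k)).
  apply: (H _ mu).
  - by move=> i; rewrite inE => /eqP ne; apply: NNPP => /mua.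
  - by move=> i; rewrite inE => /eqP.
  move=> j; have := emu j; rewrite /e /d mvB /vadd /vsub /vscal; lra.
(* [N] serves both as threshold and as constant, so one maximum over the active sets controls both;
   enlarging the constant is harmless because [V] does not increase. *)
have [||N HN] := @fin_uniform {set 'I_p} (fun A N => forall k, (N <= k)%nat -> act k = A ->
    V k.+1 - l <= INR N * (V k - V k.+1)).
- move=> A m N mN H k Nk Ak; have := H k (leq_trans mN Nk) Ak.
  have := le_INR _ _ (leP mN); have := eM k; have := dot_ge0 (e k) => h1 h2 h3 h4.
  have : 0 <= V k - V k.+1 by nra.
  nra.
- move=> A; have [delta [kappa [v [delta0 [kappa0 H]]]]] := face_value_bound q a b A sQ.
  have [N1 HN1] := small _ (Rdiv_lt_0_compat _ _ delta0 M0).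
  have ed k : (N1 <= k)%nat -> dot (e k) (e k) < delta.
    move=> /HN1 h; apply: Rle_lt_trans (eM k) _.
    apply: (@Rle_lt_trans _ (M * (V k - l))).
      by apply: Rmult_le_compat_l; [lra|have := lx k.+1; rewrite /V; lra].
    have := Rmult_lt_compat_l _ _ _ M0 h.
    by have -> : M * (delta / M) = delta by field; lra.
  have km0 : 0 < kappa * M by nra.
  have ky k : kappa * dot (e k) (e k) <= kappa * M * (V k - V k.+1).
    by rewrite Rmult_assoc; apply: Rmult_le_compat_l; [lra|exact: eM].
  case: (Req_dec v l) => [vl|vl].
    have [N2 HN2] := INR_unbounded (kappa * M).
    exists (maxn N1 N2) => k Nk Ak.
    have N1k : (N1 <= k)%nat := leq_trans (leq_maxl _ _) Nk.
    have := face _ _ _ _ _ Ak H (ed k N1k); have := ky k.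
    have := Rle_abs (phi Q q (y k) - v); have := xy k.
    have : INR N2 <= INR (maxn N1 N2) by apply: le_INR; apply/leP; exact: leq_maxr.
    have V0 : 0 <= V k - V k.+1 by have := eM k; have := dot_ge0 (e k); nra.
    rewrite vl /V => h1 h2 h3 h4 h5.
    apply: (@Rle_trans _ (kappa * M * (V k - V k.+1))); first by rewrite /V; lra.
    by apply: Rmult_le_compat_r => //; lra.
  (* If [v] differs from [l], no late [k] has active set [A]: [phi (y k)] would be within half of
     [|v - l|] of both values. *)
  have gap : 0 < Rabs (v - l) / 2 by have := Rabs_pos_lt (v - l); lra.
  have [N2 HN2] := small _ gap.
  have [N3 HN3] := small _ (Rdiv_lt_0_compat _ _ gap km0).
  exists (maxn N1 (maxn N2 N3)) => k; rewrite !geq_max => /andP[N1k /andP[N2k N3k]] Ak.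
  exfalso; have h1 := face _ _ _ _ _ Ak H (ed k N1k).
  have h2 : kappa * M * (V k - V k.+1) < Rabs (v - l) / 2.
    apply: (@Rle_lt_trans _ (kappa * M * (V k - l))).
      by apply: Rmult_le_compat_l; [lra|have := lx k.+1; rewrite /V; lra].
    have := Rmult_lt_compat_l _ _ _ km0 (HN3 k N3k).
    have -> : kappa * M * (Rabs (v - l) / 2 / (kappa * M)) = Rabs (v - l) / 2 by field; lra.
    by [].
  have h3 : Rabs (phi Q q (y k) - l) <= V k - l.
    have := subproblem_descent sQ adm (fx k) (sub k); have := dot_ge0 (vsub (y k) (x k)).
    have := lx k.+1; have := xy k => h4 h5 h6 h7; rewrite Rabs_pos_eq /V; nra.
  have := Rabs_triang (v - phi Q q (y k)) (phi Q q (y k) - l).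
  rewrite (Rabs_minus_sym v).
  have -> : v - phi Q q (y k) + (phi Q q (y k) - l) = v - l by ring.
  by have := HN2 k N2k; have := ky k; lra.
exists (INR N + 1), N; split; first by have := pos_INR N; lra.
move=> k Nk; have := HN _ k Nk erefl.
have : 0 <= V k - V k.+1 by have := eM k; have := dot_ge0 (e k); nra.
rewrite /V; nra.
Qed.

(** * Geometric convergence of the iterates *)

Theorem theorem4p3 (n p : nat) (Q : mat n) (q : vec n)
  (a : 'I_p -> vec n) (b : 'I_p -> R) (sigma alpha beta : R) (x : nat -> vec n) :
  mx_symmetric Q ->
  sigma_admissible Q sigma ->
  has_solution Q q a b ->
  bdca_sequence Q q a b sigma alpha beta x ->
  exists xstar : vec n,
    KKT Q q a b xstar /\
    exists C mu : R, 0 < C /\ 0 < mu < 1 /\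
      exists K : nat, forall k : nat, (K <= k)%nat ->
        vnorm (vsub (x k) xstar) <= C * mu ^ k.
Proof.
move=> sQ adm [xs [_ xsmin]] [fx0 [al0 [be step]]].
have s0 : 0 < sigma by case: adm.
have fx k : feasible a b (x k).
  elim: k => // k fk.
  by have [? [_ []]] := bdca_step_descent sQ adm al0 be fk (step k).
have [y Hy] := boolp.choice (fun k => bdca_step_descent sQ adm al0 be (fx k) (step k)).
set c := Rmin _ _ in Hy; have c0 : 0 < c by apply: Rmin_pos; lra.
have sub k := proj1 (Hy k); have xy k := proj1 (proj2 (proj2 (Hy k))).
have desc k := proj2 (proj2 (proj2 (Hy k))).
pose V k := phi Q q (x k).
have Vdec : Un_decreasing V.
  by move=> k; have := desc k; have := dot_ge0 (vsub (x k.+1) (x k)); rewrite /V; nra.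
have [|l Vl] := decreasing_cv V Vdec.
  exists (- phi Q q xs) => _ [k ->]; rewrite /opp_seq /V.
  by have := xsmin _ (fx k); lra.
have lV := decreasing_ineq _ _ Vdec Vl.
have [D [K [D0 HD]]] := bdca_value_contraction sQ adm fx sub xy lV Vl.
have [||B [th [B0 [th01 HB]]]] := @linear_rate (fun k => V k - l) D K D0.
- by move=> k; have := lV k; lra.
- move=> k /HD; rewrite /V; lra.
(* Squared steps are bounded by gaps of order [th ^ k], so the steps themselves decay at the square
   root of this rate. *)
pose mu := sqrt th.
have mu2 : mu * mu = th by apply: sqrt_sqrt; lra.
have mu0 : 0 < mu by apply: sqrt_lt_R0; lra.
have mu01 : 0 < mu < 1 by split=> //; nra.
pose C1 := sqrt (B / c).
have Bc : 0 <= B / c by apply: Rle_mult_inv_pos; lra.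
have C10 : 0 <= C1 by exact: sqrt_pos.
have stepi i k : (K <= k)%nat -> Rabs (x k.+1 i - x k i) <= C1 * mu ^ k.
  move=> Kk; have mk : 0 <= mu ^ k by apply: pow_le; lra.
  rewrite -(Rabs_pos_eq (C1 * mu ^ k)); last exact: Rmult_le_pos.
  apply: Rsqr_le_abs_0; apply: Rle_trans (sqr_le_dot (vsub (x k.+1) (x k)) i) _.
  have -> : Rsqr (C1 * mu ^ k) = B / c * th ^ k.
    by rewrite Rsqr_mult Rsqr_sqrt // -mu2 Rpow_mult_distr.
  apply: (Rmult_le_reg_l c) => //.
  have -> : c * (B / c * th ^ k) = B * th ^ k by field; lra.
  have hB : V k - l <= B * th ^ k := HB k Kk.
  by have := desc k; have := lV k.+1; rewrite /V in hB *; lra.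
have [xl Hxl] := boolp.choice (fun i => geometric_steps_cvg C10 mu01 (stepi i)).
have xcv i : Un_cv (fun k => x k i) (xl i) := proj1 (Hxl i).
(* The objective gap also controls [|y k - x k|^2], so [y k] has the same limit and the [sigma] term
   drops out of the limiting variational inequality. *)
have dcv i : Un_cv (fun k => y k i - x k i) 0.
  move=> eps e0; have h0 : 0 < sigma / 2 * (eps * eps).
    by apply: Rmult_lt_0_compat; [lra | exact: Rmult_lt_0_compat].
  have [N HN] := Vl _ h0; exists N => k Nk.
  have := HN k Nk; rewrite /Rdist Rminus_0_r => h1.
  rewrite -(Rabs_pos_eq eps); last lra.
  apply: Rsqr_lt_abs_0; apply: Rle_lt_trans (sqr_le_dot (vsub (y k) (x k)) i) _.
  apply: (Rmult_lt_reg_l (sigma / 2)); first lra.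
  have := subproblem_descent sQ adm (fx k) (sub k); have := xy k; have := lV k.+1.
  by have := Rle_abs (V k - l); rewrite /V /Rsqr in h1 *; lra.
have ycv i : Un_cv (fun k => y k i) (xl i).
  have := CV_plus _ _ _ _ (xcv i) (dcv i); rewrite Rplus_0_r.
  by apply: Un_cv_ext => k; ring.
exists xl; split.
  apply: vi_KKT.
    move=> i; apply: Rle_cv_lim (Un_cv_const (b i)) => [k|]; first exact: (fx k i).
    by apply: Un_cv_dot => // j; exact: Un_cv_const.
  move=> z fz; apply: Rle_cv_lim (Un_cv_const 0) _.
    by move=> k; exact: (subproblem_vi s0 (sub k) fz).
  apply: Un_cv_dot => i; last by apply: CV_minus => //; exact: Un_cv_const.
  rewrite -[vadd (mv Q xl) q i]Rplus_0_l -(Rmult_0_r sigma).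
  apply: CV_plus; first by apply: CV_mult; [exact: Un_cv_const | exact: dcv].
  apply: CV_plus; last exact: Un_cv_const.
  by apply: Un_cv_dot => // j; exact: Un_cv_const.
(* [S] is the dimension [n]: coordinatewise bounds cost a factor [sqrt S] in norm. The [+ 1] below
   keeps the constant positive. *)
pose S := rsum (fun _ : 'I_n => 1); pose C2 := C1 / (1 - mu).
have C20 : 0 <= C2 by apply: Rle_mult_inv_pos; lra.
exists (sqrt S * C2 + 1), mu; split.
  by have := Rmult_le_pos _ _ (sqrt_pos S) C20; lra.
split=> //; exists K => k Kk.
have mk : 0 <= mu ^ k by apply: pow_le; lra.
have r0 : 0 <= C2 * mu ^ k by exact: Rmult_le_pos.
apply: (@Rle_trans _ (sqrt S * (C2 * mu ^ k))); last by lra.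
rewrite -[X in _ <= sqrt S * X]sqrt_square // -sqrt_mult_alt; last first.
  by apply: rsum_ge0 => i; lra.
apply: sqrt_le_1_alt; rewrite -rsumZr; apply: rsum_le => i; rewrite Rmult_1_l.
apply: Rsqr_le_abs_1; rewrite (Rabs_pos_eq _ r0).
exact: (proj2 (Hxl i) k Kk).
Qed.
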